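(* Let $f$ be a voting profile on a connected, closed Condorcet domain $D\subseteq W$. If $\operatorname{supp}(f)=D$, then $f$ has only simple ties.
   Context: Let $\Phi$ be a finite root system in a real Euclidean space (a finite set of nonzero vectors with $\Phi\cap\mathbb{R}\alpha=\{\alpha,-\alpha\}$ and $s_\alpha(\Phi)=\Phi$ for all $\alpha\in\Phi$, where $s_\alpha$ is the orthogonal reflection in $\alpha^\perp$; not necessarily crystallographic). Let $\Phi^+$ be a choice of positive roots, $\Phi^-=\Phi\setminus\Phi^+$, and let $W=W(\Phi)$ be the finite Coxeter group generated by the $s_\alpha$. For $w\in W$, the (left) inversion set is $I(w):=\{\alpha\in\Phi\mid w^{-1}\alpha\in\Phi^-\}$ (negative roots are allowed, so exactly one of $\alpha,-\alpha$ lies in $I(w)$). A set of three roots $\{\alpha,\beta,\gamma\}\subseteq\Phi$ is a root-triple if there exist real $a,b,c>0$ with $a\alpha+b\beta+c\gamma=0$. A nonempty subset $D\subseteq W$ is a Condorcet domain if there do not exist distinct $u,v,w\in D$ and a root-triple $\{\alpha,\beta,\gamma\}$ such that $\alpha,\beta\in I(u)$, $\alpha,\gamma\in I(v)$, $\beta,\gamma\in I(w)$. A voting profile on $D$ is a map $f:D\to\mathbb{Z}_{\ge0}$, not constantly zero. Put $f(\alpha)=\sum_{w\in D,\ \alpha\in I(w)}f(w)$ for $\alpha\in\Phi$, $|f|=\sum_{w\in D}f(w)$, $I(f)=\{\alpha\in\Phi\mid f(\alpha)\ge|f|/2\}$ and $R(f)=\{w\in W\mid I(w)\subseteq I(f)\}$.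 $f$ has no tie if $f(\alpha)\ne|f|/2$ for all $\alpha\in\Phi$. Let $\nu(D)=\bigcup_g R(g)$ over all voting profiles $g$ on $D$ with no tie. A Condorcet domain $D$ is closed if $\nu(D)=D$ (equivalently $\nu(D)\subseteq D$). $D$ is connected if for any $u,v\in D$ there exist $m\ge0$ and a sequence $w_0=u,w_1,\dots,w_m=v$ in $D$ with $|I(w_{i+1})\setminus I(w_i)|=1$ for all $0\le i\le m-1$. The support of $f$ is $\operatorname{supp}(f)=\{v\in D\mid f(v)>0\}$. The profile $f$ has only simple ties if $R(f)\subseteq\nu(\operatorname{supp}(f))$. *)

(* Defs.v *)
From HB Require Import structures.
From mathcomp Require Import all_boot all_order all_algebra finmap.
From mathcomp Require Import sesquilinear classical_sets reals.

Set Implicit Arguments.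
Unset Strict Implicit.
Unset Printing Implicit Defensive.

Import Order.TTheory GRing.Theory Num.Theory.

Local Open Scope classical_set_scope.
Local Open Scope ring_scope.

Section RootSystem.
Variables (R : realType) (V : vectType R) (dot : {dot V for idfun}).

Definition refl_fun (a v : V) : V := v - (2 * dot v a / dot a a) *: a.

Lemma refl_fun_linear a : linear (refl_fun a).
Proof.
move=> c u v; rewrite /refl_fun linearPl /= mulrDr mulrDl scalerDl scalerBr.
rewrite opprD addrACA; congr (_ - _ + _); rewrite scalerA; congr (_ *: _).
by rewrite mulrCA -!mulrA.
Qed.

HB.instance Definition _ a :=
  GRing.isLinear.Build R V V *:%R (refl_fun a) (refl_fun_linear a).

Definition refl (a : V) : 'End(V) := linfun (refl_fun a).

Lemma reflE a v : refl a v = v - (2 * dot v a / dot a a) *: a.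
Proof. by rewrite lfunE. Qed.

Definition root_system (Phi : {fset V}) : Prop :=
  [/\ 0 \notin Phi,
      forall a, a \in Phi ->
        [set` Phi] `&` [set c *: a | c in [set: R]] = [set a; - a]
    & forall a, a \in Phi -> [fset refl a b | b in Phi]%fset = Phi].

(* Positive roots are those on the positive side of a hyperplane through the
   origin containing no root. *)
Definition positive_system (Phi Pos : {fset V}) : Prop :=
  exists2 x : V, forall a, a \in Phi -> dot x a != 0
               & Pos = [fset a in Phi | 0 < dot x a]%fset.

(* [w^-1] is the library's inverse of linear maps, which is a two-sided inverse
   here because all elements of [coxeter_group Phi] are bijective. *)
Inductive coxeter_group (Phi : {fset V}) : set 'End(V) :=
| coxeter_refl a : a \in Phi -> coxeter_group Phi (refl a)
| coxeter_id : coxeter_group Phi \1%VF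
| coxeter_comp u w :
    coxeter_group Phi u -> coxeter_group Phi w -> coxeter_group Phi (u \o w)%VF
| coxeter_inv w : coxeter_group Phi w -> coxeter_group Phi (w^-1)%VF.

Definition root_triple (Phi : {fset V}) (a b c : V) : Prop :=
  [/\ [/\ a \in Phi, b \in Phi & c \in Phi],
      [/\ a != b, a != c & b != c]
    & exists x y z : R, [/\ 0 < x, 0 < y, 0 < z
                          & x *: a + y *: b + z *: c = 0]].

Variables Phi Pos : {fset V}.

Definition inv_set (w : 'End(V)) : {fset V} :=
  [fset a in Phi | (w^-1)%VF a \in Phi `\` Pos]%fset.

Definition condorcet_domain (D : {fset 'End(V)}) : Prop :=
  [/\ D != fset0%fset,
      [set` D] `<=` coxeter_group Phi
    & ~ exists u v w, exists a b c,
        [/\ [/\ u \in D, v \in D & w \in D],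
            [/\ u != v, u != w & v != w],
            root_triple Phi a b c
          & [/\ a \in inv_set u /\ b \in inv_set u,
                a \in inv_set v /\ c \in inv_set v
              & b \in inv_set w /\ c \in inv_set w]]].

Section Profile.
Variables (D : {fset 'End(V)}) (f : {ffun D -> nat}).

Definition voting_profile : Prop := exists w, f w != 0%N.

Definition votes (a : V) : nat := (\sum_(w : D | a \in inv_set (val w)) f w)%N.

Definition total_votes : nat := (\sum_(w : D) f w)%N.

Definition majority : {fset V} :=
  [fset a in Phi | total_votes%:R / 2 <= (votes a)%:R :> R]%fset.

Definition winners : set 'End(V) :=
  [set w | coxeter_group Phi w /\ (inv_set w `<=` majority)%fset].

Definition no_tie : Prop :=
  forall a, a \in Phi -> (votes a)%:R != total_votes%:R / 2 :> R.

Definition supp : {fset 'End(V)} := [fset val w | w : D & (0 < f w)%N]%fset.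

End Profile.

Definition nu (D : {fset 'End(V)}) : set 'End(V) :=
  \bigcup_(g in [set g : {ffun D -> nat} | voting_profile g /\ no_tie g])
    winners g.

Definition condorcet_closed (D : {fset 'End(V)}) : Prop := nu D = [set` D].

Definition condorcet_connected (D : {fset 'End(V)}) : Prop :=
  forall u v, u \in D -> v \in D ->
    exists p : seq 'End(V),
      [/\ {subset p <= D},
          path (fun x y => #|` (inv_set y `\` inv_set x)%fset| == 1%N) u p
        & last u p = v].

Definition simple_ties (D : {fset 'End(V)}) (f : {ffun D -> nat}) : Prop :=
  winners f `<=` nu (supp f).

End RootSystem.

(* Main.v *)
Require Import Defs.
From HB Require Import structures.
From mathcomp Require Import all_boot all_order all_algebra finmap.
From mathcomp Require Import sesquilinear classical_sets reals.
From mathcomp Require Import zify.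

(** Ties are broken by a small perturbation of the profile.  Let [w] be a winner
    of [f], and let [T] be the set of roots of [I(w)] on which [f] is tied.  As
    every voter of [D] has positive weight, a large multiple of [f] can absorb
    a small transfer of votes between elements of [D] and remain a profile.  The
    point is that the ties can be moved independently of each other.  Call
    [(u, v)] an arrow of [a] if [I(v) \ I(u) = {a}].  For elements of the Coxeter
    group, exactly one of [a] and [-a] lies in each inversion set, so moving a
    vote from [u] to [v] raises the count of [a] by one, lowers that of [-a] by
    one, and changes nothing else.

    Every tied root [a] has an arrow inside [D]: a tie with a positive total
    means that some [u] in [D] omits [a] and some [v] in [D] contains it, and
    on a path from [u] to [v] the root [a] must be added at some step, alone
    ([connected_adds], [tied_root_added]).  So [f] is multiplied by [#|D| + 1]
    and one vote is transferred along every arrow of every root of [T]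
    ([transfer]).  A root [a] of [I(w)] never loses votes, since an arrow along
    which [a] disappears adds [-a], and [-a] is not in [T]; if [a] is tied it
    gains at least one.  Hence each root of [I(w)] gets a strict majority
    ([transfer_strict_majority]).  Since every root is in [I(w)] or has its
    opposite there, the new profile has no tie, and [w] is a winner of it. *)

Set Implicit Arguments.
Unset Strict Implicit.
Unset Printing Implicit Defensive.

Import Order.TTheory GRing.Theory Num.Theory.

Local Open Scope classical_set_scope.
Local Open Scope ring_scope.

(** * Roots and inversion sets under the Coxeter group *)

Lemma refl_self (R : realType) (V : vectType R) (dot : {dot V for idfun})
    (a : V) :
  a != 0 -> refl dot a a = - a.
Proof.
move=> /(neq0_dnorm_gt0 (s := dot)) /lt0r_neq0 da.
by rewrite reflE mulfK // scaler_nat mulr2n opprD addNKr.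
Qed.

Lemma reflK (R : realType) (V : vectType R) (dot : {dot V for idfun})
    (a : V) :
  a != 0 -> involutive (refl dot a).
Proof.
by move=> a0 v; rewrite [X in refl dot a X]reflE linearB linearZ /= refl_self //
  scalerN opprK reflE subrK.
Qed.

Lemma root_systemN (R : realType) (V : vectType R) (dot : {dot V for idfun})
    (Phi : {fset V}) (a : V) :
  root_system dot Phi -> a \in Phi -> - a \in Phi.
Proof.
move=> [Phi0 _ hrefl] aPhi; rewrite -(hrefl a aPhi) -(refl_self dot).
  exact: in_imfset.
by apply: contraNneq Phi0 => <-.
Qed.

(** Stating that [w] reflects as well as preserves membership in [Phi] makes the
    induction pass through inverses; injectivity makes [w^-1] a genuine
    two-sided inverse. *)
Lemma coxeter_group_roots (R : realType) (V : vectType R)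
    (dot : {dot V for idfun}) (Phi : {fset V}) (w : 'End(V)) :
  root_system dot Phi -> coxeter_group dot Phi w ->
  lker w == 0%VS /\ forall a, (w a \in Phi) = (a \in Phi).
Proof.
move=> [Phi0 _ hrefl]; elim=> {w} [a aPhi| |u w _ [ku hu] _ [kw hw]|w _ [kw hw]].
- have a0 : a != 0 by apply: contraNneq Phi0 => <-.
  have stable b : b \in Phi -> refl dot a b \in Phi.
    by move=> bPhi; rewrite -(hrefl a aPhi); exact: in_imfset.
  split; first by apply/lker0P; exact: can_inj (reflK dot a0).
  by move=> b; apply/idP/idP => /stable //; rewrite reflK.
- by split=> [|a]; [apply/lker0P => a b|]; rewrite !id_lfunE.
- split=> [|a]; last by rewrite comp_lfunE hu hw.
  apply/lker0P => a b; rewrite !comp_lfunE => /(lker0P ku).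
  exact: (lker0P kw).
- split=> [|a]; last by rewrite -hw lker0_lfunVK.
  by apply/lker0P; exact: can_inj (lker0_lfunVK kw).
Qed.

Lemma mem_inv_set (R : realType) (V : vectType R) (dot : {dot V for idfun})
    (Phi Pos : {fset V}) (w : 'End(V)) (x a : V) :
  root_system dot Phi -> coxeter_group dot Phi w ->
  (forall b, b \in Phi -> dot x b != 0) ->
  Pos = [fset b in Phi | 0 < dot x b]%fset -> a \in Phi ->
  (a \in inv_set Phi Pos w) = (dot x ((w^-1)%VF a) < 0).
Proof.
move=> rs wW xreg -> aPhi; have [kw hw] := coxeter_group_roots rs wW.
have bPhi : (w^-1)%VF a \in Phi by rewrite -hw lker0_lfunVK.
rewrite !inE; apply/and3P/idP => [[_ /nandP[/negP[] //|xle] _]|xneg].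
  by move: xle; rewrite -leNgt le_eqVlt (negPf (xreg _ bPhi)).
by split=> //; apply/nandP; right; rewrite -leNgt ltW.
Qed.

Lemma inv_setN (R : realType) (V : vectType R) (dot : {dot V for idfun})
    (Phi Pos : {fset V}) (w : 'End(V)) (a : V) :
  root_system dot Phi -> positive_system dot Phi Pos ->
  coxeter_group dot Phi w -> a \in Phi ->
  (- a \in inv_set Phi Pos w) = (a \notin inv_set Phi Pos w).
Proof.
move=> rs [x xreg hPos] wW aPhi; have [kw hw] := coxeter_group_roots rs wW.
rewrite !(mem_inv_set rs wW xreg hPos) ?(root_systemN rs) //.
have := xreg ((w^-1)%VF a); rewrite -hw lker0_lfunVK // => /(_ aPhi) xa.
by rewrite !linearN oppr_lt0 -leNgt le_eqVlt eq_sym (negPf xa).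
Qed.

(** * Arrows between inversion sets and transfers of votes *)

Definition added_roots (R : realType) (V : vectType R) (Phi Pos : {fset V})
    (u v : 'End(V)) : {fset V} :=
  (inv_set Phi Pos v `\` inv_set Phi Pos u)%fset.

(** Along a path from [u] to [v] the root [a] appears at some step, and a step
    adds a single root. *)
Lemma connected_adds (R : realType) (V : vectType R) (Phi Pos : {fset V})
    (D : {fset 'End(V)}) (a : V) (u v : D) :
  condorcet_connected Phi Pos D ->
  a \notin inv_set Phi Pos (val u) -> a \in inv_set Phi Pos (val v) ->
  exists p : D * D, added_roots Phi Pos (val p.1) (val p.2) = [fset a]%fset.
Proof.
move=> conn; have [p [pD pth <-]] := conn _ _ (valP u) (valP v).
elim: p u pD pth => [|y p IHp] u pD /=; first by move=> _ /negPf ->.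
move=> /andP[/cardfs1P[b Eb] pth] au alast.
have yD : y \in D by apply: pD; rewrite mem_head.
have [ay|ay] := boolP (a \in inv_set Phi Pos y).
  exists (u, [` yD]%fset); rewrite /added_roots /= Eb; congr [fset _]%fset.
  have : a \in (inv_set Phi Pos y `\` inv_set Phi Pos (val u))%fset.
    by rewrite in_fsetD ay au.
  by rewrite Eb inE => /eqP.
apply: (IHp [` yD]%fset) => // z zp; apply: pD.
by rewrite in_cons zp orbT.
Qed.

(** Summed over the vertices of [P], in-degree minus out-degree counts only the
    arrows that cross the boundary of [P], since those inside [P] cancel. *)
Lemma flow_balance (T : finType) (E : rel T) (P : pred T) :
  (\sum_(v | P v) #|[pred u | E u v]|
   + #|[pred p : T * T | [&& E p.1 p.2, P p.1 & ~~ P p.2]]|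
   = \sum_(u | P u) #|[pred v | E u v]|
   + #|[pred p : T * T | [&& E p.1 p.2, ~~ P p.1 & P p.2]]|)%N.
Proof.
have -> : (\sum_(v | P v) #|[pred u | E u v]|
    = \sum_(p : T * T | E p.1 p.2 && P p.2) 1)%N.
  under eq_bigr => v _ do rewrite -sum1_card.
  rewrite (exchange_big_dep predT) //= pair_big_dep /=.
  by apply: eq_bigl => p; rewrite !inE andbC.
have -> : (\sum_(u | P u) #|[pred v | E u v]|
    = \sum_(p : T * T | E p.1 p.2 && P p.1) 1)%N.
  under eq_bigr => v _ do rewrite -sum1_card.
  rewrite pair_big_dep /=.
  by apply: eq_bigl => p; rewrite !inE andbC.
rewrite !sum1_card.
(* The arrows with both ends in [P] occur on both sides and are cancelled. *)
rewrite -(cardID (fun p : T * T => P p.1) (fun p => E p.1 p.2 && P p.2)).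
rewrite -[in RHS](cardID (fun p : T * T => P p.2) (fun p => E p.1 p.2 && P p.1)).
have -> : #|[predI (fun p : T * T => E p.1 p.2 && P p.2) & (fun p => P p.1)]|
  = #|[predI (fun p : T * T => E p.1 p.2 && P p.1) & (fun p => P p.2)]|.
  by apply: eq_card => p; rewrite !inE /= /in_mem /= andbAC.
rewrite -!addnA; congr addn.
rewrite addnC; congr addn; apply: eq_card => p;
  rewrite !inE /= /in_mem /=; by case: (E _ _) (P _) (P _) => [] [] [].
Qed.

Definition added_in (R : realType) (V : vectType R) (Phi Pos : {fset V})
    (D : {fset 'End(V)}) (T : {fset V}) : rel D :=
  fun u v => (#|` added_roots Phi Pos (val u) (val v)| == 1%N)
    && (added_roots Phi Pos (val u) (val v) `<=` T)%fset.

(** One vote moves along each arrow of [E].  The factor [#|X| + 1] exceeds every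
    out-degree, so that the truncated subtraction is an exact one as soon as
    [f] is positive. *)
Definition transfer (K : choiceType) (X : {fset K}) (E : rel X)
    (f : {ffun X -> nat}) : {ffun X -> nat} :=
  [ffun v => f v * #|` X|.+1 + #|[pred u | E u v]| - #|[pred u | E v u]|]%N.

Lemma transfer_gt (K : choiceType) (X : {fset K}) (E : rel X)
    (f : {ffun X -> nat}) (v : X) :
  (0 < f v -> #|[pred u | E v u]| < f v * #|` X|.+1)%N.
Proof.
move=> fv; apply: (@leq_trans #|` X|.+1); last exact: leq_pmull.
by rewrite ltnS cardfE max_card.
Qed.

Lemma sum_transfer (K : choiceType) (X : {fset K}) (E : rel X)
    (f : {ffun X -> nat}) (P : pred X) :
  (forall v, 0 < f v)%N ->
  (\sum_(v | P v) transfer E f v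
   + #|[pred p : X * X | [&& E p.1 p.2, P p.1 & ~~ P p.2]]|
   = (\sum_(v | P v) f v) * #|` X|.+1
   + #|[pred p : X * X | [&& E p.1 p.2, ~~ P p.1 & P p.2]]|)%N.
Proof.
move=> fpos.
(* Adding back the subtracted out-degrees reduces to [flow_balance]. *)
apply/eqP; rewrite -(eqn_add2l (\sum_(u | P u) #|[pred v | E u v]|)).
rewrite [eqbRHS]addnCA -flow_balance !addnA eqn_add2r big_distrl /= -!big_split /=.
apply/eqP/eq_bigr => v _; rewrite ffunE subnKC //.
exact/ltnW/ltn_addr/transfer_gt.
Qed.

(** * Breaking the ties of a winner *)

Lemma nat_half_le (R : realType) (m n : nat) :
  (m%:R / 2 <= n%:R :> R) = (m <= n.*2)%N.
Proof. by rewrite ler_pdivrMr // -natrM muln2 ler_nat. Qed.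

Lemma nat_half_eq (R : realType) (m n : nat) :
  (n%:R == m%:R / 2 :> R) = (n.*2 == m).
Proof.
rewrite -[n%:R]divr1 eqr_div ?oner_neq0 ?pnatr_eq0 // mulr1 -natrM muln2.
exact: eqr_nat.
Qed.

Lemma votesN (R : realType) (V : vectType R) (dot : {dot V for idfun})
    (Phi Pos : {fset V}) (D : {fset 'End(V)}) (f : {ffun D -> nat}) (a : V) :
  root_system dot Phi -> positive_system dot Phi Pos ->
  [set` D] `<=` coxeter_group dot Phi -> a \in Phi ->
  (votes Phi Pos f a + votes Phi Pos f (- a) = total_votes f)%N.
Proof.
move=> rs ps DW aPhi.
rewrite /total_votes (bigID (fun v : D => a \in inv_set Phi Pos (val v))) /=.
congr addn; apply: eq_bigl => v.
by rewrite (inv_setN rs ps) //; apply/DW/valP.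
Qed.

(** A tied root is an inversion of some voters and not of others, because the
    total is positive, so connectedness provides an arrow for it. *)
Lemma tied_root_added (R : realType) (V : vectType R) (Phi Pos : {fset V})
    (D : {fset 'End(V)}) (f : {ffun D -> nat}) (a : V) :
  condorcet_connected Phi Pos D -> voting_profile f ->
  total_votes f = (votes Phi Pos f a).*2 ->
  exists p : D * D, added_roots Phi Pos (val p.1) (val p.2) = [fset a]%fset.
Proof.
move=> conn [v0 fv0] tie.
have tot0 : (0 < total_votes f)%N.
  by rewrite /total_votes (bigD1 v0) //= ltn_addr // lt0n.
have [u au] : exists u : D, a \notin inv_set Phi Pos (val u).
  apply/existsP; apply: contraLR tot0 => /existsPn all_a.
  suff : votes Phi Pos f a = total_votes f by lia.
  by apply: eq_bigl => v; apply: negbNE; exact: all_a.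
have [v av] : exists v : D, a \in inv_set Phi Pos (val v).
  apply/existsP; apply: contraLR tot0 => /existsPn no_a.
  suff : votes Phi Pos f a = 0%N by lia.
  by rewrite /votes big_pred0 // => v; apply: negbTE; exact: no_a.
exact: connected_adds conn au av.
Qed.

Definition tied_inversions (R : realType) (V : vectType R) (Phi Pos : {fset V})
    (D : {fset 'End(V)}) (f : {ffun D -> nat}) (w : 'End(V)) : {fset V} :=
  [fset a in inv_set Phi Pos w
     | (votes Phi Pos f a).*2 == total_votes f]%fset.

Lemma mem_tied_inversions (R : realType) (V : vectType R) (Phi Pos : {fset V})
    (D : {fset 'End(V)}) (f : {ffun D -> nat}) (w : 'End(V)) (a : V) :
  (a \in tied_inversions Phi Pos f w)
  = (a \in inv_set Phi Pos w) && ((votes Phi Pos f a).*2 == total_votes f).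
Proof. by rewrite !inE. Qed.

Lemma inv_set_root (R : realType) (V : vectType R) (Phi Pos : {fset V})
    (w : 'End(V)) (a : V) :
  a \in inv_set Phi Pos w -> a \in Phi.
Proof. by rewrite !inE => /and3P[]. Qed.

(** The transfer keeps the total (up to the factor) and no arrow in use removes
    an inversion [a] of [w], since it would add [-a], which is not an inversion
    of [w].  So a strict majority for [a] persists, while a tie is broken in
    favour of [a] by its own arrow. *)
Lemma transfer_strict_majority (R : realType) (V : vectType R)
    (dot : {dot V for idfun}) (Phi Pos : {fset V}) (D : {fset 'End(V)})
    (f : {ffun D -> nat}) (w : 'End(V)) (a : V) :
  root_system dot Phi -> positive_system dot Phi Pos ->
  [set` D] `<=` coxeter_group dot Phi -> condorcet_connected Phi Pos D ->
  voting_profile f -> (forall v, 0 < f v)%N -> winners dot Phi Pos f w ->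
  a \in inv_set Phi Pos w ->
  let g := transfer (added_in Phi Pos (tied_inversions Phi Pos f w)) f in
  (total_votes g < (votes Phi Pos g a).*2)%N.
Proof.
move=> rs ps DW conn vp fpos [wW wmaj] aw /=.
set E := added_in _ _ _; have aPhi := inv_set_root aw.
have fa : (total_votes f <= (votes Phi Pos f a).*2)%N.
  rewrite -(nat_half_le R).
  by have /fsubsetP/(_ a aw) := wmaj; rewrite !inE => /andP[].
have -> : total_votes (transfer E f) = (total_votes f * #|` D|.+1)%N.
  have := sum_transfer E predT fpos.
  by rewrite !eq_card0 ?addn0 // => p; rewrite !inE /= andbF.
have noleave u v : E u v -> a \in inv_set Phi Pos (val u) ->
    a \in inv_set Phi Pos (val v).
  move=> /andP[_ /fsubsetP uvT] au; apply: contraT => av.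
  have /uvT : - a \in added_roots Phi Pos (val u) (val v).
    by rewrite in_fsetD !(inv_setN rs ps) ?au ?av //; exact/DW/valP.
  by rewrite mem_tied_inversions (inv_setN rs ps) // aw.
have := sum_transfer E (fun v => a \in inv_set Phi Pos (val v)) fpos.
rewrite [X in (_ + X = _)%N]eq_card0 ?addn0; last first.
  move=> p; rewrite [LHS]inE; apply/and3P => -[e ap].
  by rewrite (noleave _ _ e ap).
rewrite -/(votes _ _ _ _) -/(votes _ _ _ _) => ->.
have [tie|] := eqVneq (total_votes f) (votes Phi Pos f a).*2; last by nia.
(* At a tie the inequality says that some arrow makes [a] appear. *)
suff : (0 < #|[pred p : D * D | [&& E p.1 p.2,
    a \notin inv_set Phi Pos (val p.1) & a \in inv_set Phi Pos (val p.2)]]|)%N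
  by nia.
have [p pa] := tied_root_added conn vp tie.
apply/card_gt0P; exists p; rewrite inE /E /added_in pa cardfs1 fsub1set.
rewrite -in_fsetD -/(added_roots _ _ _ _) pa fset11 andbT /=.
by rewrite mem_tied_inversions aw tie eqxx.
Qed.

(** * Winners of a positive profile *)

Lemma winners_sub_nu (R : realType) (V : vectType R) (dot : {dot V for idfun})
    (Phi Pos : {fset V}) (D : {fset 'End(V)}) (f : {ffun D -> nat}) :
  root_system dot Phi -> positive_system dot Phi Pos ->
  [set` D] `<=` coxeter_group dot Phi -> condorcet_connected Phi Pos D ->
  voting_profile f -> (forall v, 0 < f v)%N ->
  winners dot Phi Pos f `<=` nu dot Phi Pos D.
Proof.
move=> rs ps DW conn vp fpos w winw; have [wW _] := winw.
pose g := transfer (added_in Phi Pos (tied_inversions Phi Pos f w)) f.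
have gmaj a : a \in inv_set Phi Pos w ->
    (total_votes g < (votes Phi Pos g a).*2)%N.
  exact: transfer_strict_majority rs ps DW conn vp fpos winw.
exists g; last first.
  split=> //; apply/fsubsetP => a aw; rewrite !inE nat_half_le ltnW ?gmaj //.
  by rewrite andbT (inv_set_root aw).
split.
  have [v0 _] := vp; exists v0; rewrite ffunE -lt0n subn_gt0.
  exact/ltn_addr/transfer_gt.
move=> a aPhi; rewrite nat_half_eq.
have [aw|aw] := boolP (a \in inv_set Phi Pos w).
  by have := gmaj a aw; case: ltngtP.
(* Otherwise [-a] has a strict majority and [a] a strict minority. *)
have := gmaj (- a); rewrite (inv_setN rs ps) // => /(_ aw).
have := votesN g rs ps DW aPhi; lia.
Qed.

Theorem theorem1p10 (R : realType) (V : vectType R) (dot : {dot V for idfun})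
    (Phi Pos : {fset V}) (D : {fset 'End(V)}) (f : {ffun D -> nat}) :
  root_system dot Phi ->
  positive_system dot Phi Pos ->
  condorcet_domain dot Phi Pos D ->
  condorcet_closed dot Phi Pos D ->
  condorcet_connected Phi Pos D ->
  voting_profile f ->
  supp f = D ->
  simple_ties dot Phi Pos f.
Proof.
move=> rs ps [_ DW _] _ conn vp suppD; rewrite /simple_ties suppD.
apply: winners_sub_nu => // v.
have : val v \in supp f by rewrite suppD; exact: valP.
by case/imfsetP => u; rewrite /= inE => fu /val_inj ->.
Qed.
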